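(* Let $\mathcal C$ be a finitely complete category and consider a weak factorization system on $\mathcal C$ with an $\mathrm{Id}$-presentation $R$ (so the weak factorization system is $[\mathbf F(R)]$). Then $(\mathcal C,\mathrm{alg}(\mathbf F(R)))$ models $\mathrm{Id}$-types.
   Context: Conventions: $*$ is a terminal object; finite limits are chosen; $(a,b)$ denotes the morphism into a product or pullback with components $a,b$; $A\,{}_{a}\!\times_{b}B$ is the pullback of $a:A\to Z$ and $b:B\to Z$. $\mathrm{LLP}(\mathsf D)$ is the class of morphisms with the left lifting property against all of $\mathsf D$. A relation on an object $X$ of a category consists of $\eta_X:X\to\Psi X$ and $\epsilon_{0X},\epsilon_{1X}:\Psi X\to X$ with $\epsilon_{iX}\eta_X=1_X$. A relation $R$ on a category consists of a relation on each object $X$ and, for each $f:X\to Y$, a chosen $\Psi f:\Psi X\to\Psi Y$ with $\epsilon_{iY}\Psi f=f\epsilon_{iX}$, $\Psi f\,\eta_X=\eta_Yf$ (functoriality not required). A factorization $F$ on $\mathcal C$ assigns to each $f:X\to Y$ morphisms $\lambda_Ff:X\to\Phi_Ff$, $\rho_Ff:\Phi_Ff\to Y$ with $\rho_Ff\,\lambda_Ff=f$, and to each commutative square $\langle\alpha,\beta\rangle:f\to g$ (so $g\alpha=\beta f$) a chosen $\Phi_F\langle\alpha,\beta\rangle:\Phi_Ff\to\Phi_Fg$ with $\Phi_F\langle\alpha,\beta\rangle\lambda_Ff=\lambda_Fg\,\alpha$, $\rho_Fg\,\Phi_F\langle\alpha,\beta\rangle=\beta\rho_Ff$ (functoriality not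 required). $\mathrm{coalg}(F)$ is the class of $f:X\to Y$ for which there is $s:Y\to\Phi_Ff$ with $sf=\lambda_Ff$, $\rho_Ff\,s=1_Y$; $\mathrm{alg}(F)$ is the class of $f:X\to Y$ for which there is $s:\Phi_Ff\to X$ with $s\lambda_Ff=1_X$, $fs=\rho_Ff$. $F$ is a weak factorization structure if $\lambda_Ff\in\mathrm{coalg}(F)$ and $\rho_Ff\in\mathrm{alg}(F)$ for all $f$; then $[F]=(\mathrm{coalg}(F),\mathrm{alg}(F))$ is a weak factorization system. For a relation $R$ on $\mathcal C$, $\mathbf F(R)$ is the factorization sending $f:X\to Y$ to $X\xrightarrow{(1_X,\eta_Yf)}X\,{}_{f}\!\times_{\epsilon_0}\Psi Y\xrightarrow{\epsilon_1\pi_{\Psi Y}}Y$ and $\langle\alpha,\beta\rangle$ to $\alpha\times\Psi\beta$. $(\mathcal C,\mathsf D)$ is a display map category if the class $\mathsf D$ contains all isomorphisms and all morphisms with terminal codomain, and is stable under pullback. It models $\Sigma$-types if $\mathsf D$ is closed under composition. If so, an identity type of $f:X\to Y$ in $\mathsf D$ is a relation on $f$ in $\mathcal C/Y$, with data $r_f:X\to\mathrm{Id}(f)$, $\epsilon_0,\epsilon_1:\mathrm{Id}(f)\to X$ over $Y$, such that $(\epsilon_0,\epsilon_1):\mathrm{Id}(f)\to X\times_YX$ is in $\mathsf D$, and for every $\alpha:A\to X$ in $\mathcal C$ and $i=0,1$ the morphism $(1_A,r_f\alpha):A\to A\,{}_{\alpha}\!\times_{\epsilon_i}\mathrm{Id}(f)$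 is in $\mathrm{LLP}(\mathsf D)$. $(\mathcal C,\mathsf D)$ models $\mathrm{Id}$-types if for every object $Y$ there is a relation $I_Y$ on $\mathcal C/Y$ such that $I_Y(f)$ is an identity type of $f$ for every $f\in\mathsf D$ with codomain $Y$. A relation $R$ on $\mathcal C$ is an $\mathrm{Id}$-presentation (of $[\mathbf F(R)]$) if $\mathbf F(R)$ is a weak factorization structure and, with $\mathsf D=\mathrm{alg}(\mathbf F(R))$, for each object $X$ the relation $R(X)$ is an identity type of $X\to *$ in $(\mathcal C,\mathsf D)$ (which is automatically a display map category modeling $\Sigma$-types). *)

(* Defs.v *)
From Stdlib Require Import ProofIrrelevance.

Set Implicit Arguments.
Unset Strict Implicit.
Unset Printing Implicit Defensive.

Declare Scope cat_scope.
Delimit Scope cat_scope with cat.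
Local Open Scope cat_scope.

Record Category := {
  Ob :> Type;
  Hom : Ob -> Ob -> Type;
  idm : forall X, Hom X X;
  comp : forall X Y Z, Hom Y Z -> Hom X Y -> Hom X Z;
  comp1m : forall X Y (f : Hom X Y), comp (idm Y) f = f;
  compm1 : forall X Y (f : Hom X Y), comp f (idm X) = f;
  compA : forall W X Y Z (h : Hom Y Z) (g : Hom X Y) (f : Hom W X),
    comp h (comp g f) = comp (comp h g) f
}.

Arguments Hom {c} X Y.
Arguments idm {c} X.

Notation "g ∘ f" := (comp g f) (at level 40, left associativity) : cat_scope.

(* A class of morphisms. *)
Definition MorClass (C : Category) := forall X Y : C, Hom X Y -> Prop.

Definition is_iso (C : Category) (X Y : C) (f : Hom X Y) : Prop :=
  exists g : Hom Y X, g ∘ f = idm X /\ f ∘ g = idm Y.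

Definition is_terminal (C : Category) (T : C) : Prop :=
  forall X : C, exists! f : Hom X T, True.

Definition is_pullback (C : Category) (P A B Z : C) (p : Hom P A) (q : Hom P B)
    (a : Hom A Z) (b : Hom B Z) : Prop :=
  a ∘ p = b ∘ q /\
  forall (T : C) (u : Hom T A) (v : Hom T B), a ∘ u = b ∘ v ->
    exists! h : Hom T P, p ∘ h = u /\ q ∘ h = v.

Definition has_lift (C : Category) (A B X Y : C) (j : Hom A B) (g : Hom X Y) : Prop :=
  forall (u : Hom A X) (v : Hom B Y), g ∘ u = v ∘ j ->
    exists h : Hom B X, h ∘ j = u /\ g ∘ h = v.

Definition LLP (C : Category) (D : MorClass C) : MorClass C :=
  fun A B j => forall (X Y : C) (g : Hom X Y), D X Y g -> has_lift j g.

(* Finite limits are given by a chosen terminal object and chosen pullbacks. *)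
Record FiniteLimits (C : Category) := {
  one : C;
  bang : forall X : C, Hom X one;
  bang_uniq : forall (X : C) (f : Hom X one), f = bang X;
  pb : forall (A B Z : C) (a : Hom A Z) (b : Hom B Z), C;
  pb1 : forall (A B Z : C) (a : Hom A Z) (b : Hom B Z), Hom (pb a b) A;
  pb2 : forall (A B Z : C) (a : Hom A Z) (b : Hom B Z), Hom (pb a b) B;
  pb_comm : forall (A B Z : C) (a : Hom A Z) (b : Hom B Z), a ∘ pb1 a b = b ∘ pb2 a b;
  pair : forall (A B Z : C) (a : Hom A Z) (b : Hom B Z) (T : C)
    (u : Hom T A) (v : Hom T B), a ∘ u = b ∘ v -> Hom T (pb a b);
  pb1_pair : forall (A B Z : C) (a : Hom A Z) (b : Hom B Z) (T : C)
    (u : Hom T A) (v : Hom T B) (e : a ∘ u = b ∘ v), pb1 a b ∘ pair e = u;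
  pb2_pair : forall (A B Z : C) (a : Hom A Z) (b : Hom B Z) (T : C)
    (u : Hom T A) (v : Hom T B) (e : a ∘ u = b ∘ v), pb2 a b ∘ pair e = v;
  pair_uniq : forall (A B Z : C) (a : Hom A Z) (b : Hom B Z) (T : C)
    (h k : Hom T (pb a b)),
    pb1 a b ∘ h = pb1 a b ∘ k -> pb2 a b ∘ h = pb2 a b ∘ k -> h = k
}.

Arguments one {C} L : rename.
Arguments bang {C} L X : rename.
Arguments pb {C} L {A B Z} a b : rename.
Arguments pb1 {C} L {A B Z} a b : rename.
Arguments pb2 {C} L {A B Z} a b : rename.
Arguments pb_comm {C} L {A B Z} a b : rename.
Arguments pair {C} L {A B Z a b T u v} e : rename.

Record SliceOb (C : Category) (Y : C) := { sdom : C; sarr : Hom sdom Y }.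

Record SliceHom (C : Category) (Y : C) (f g : SliceOb Y) := {
  smor : Hom (sdom f) (sdom g);
  smor_comm : sarr g ∘ smor = sarr f
}.

Lemma SliceHom_eq (C : Category) (Y : C) (f g : SliceOb Y) (h k : SliceHom f g) :
  smor h = smor k -> h = k.
Proof.
destruct h as [h hh], k as [k kk]; simpl; intros e; destruct e.
now rewrite (proof_irrelevance _ hh kk).
Qed.

Definition slice_id (C : Category) (Y : C) (f : SliceOb Y) : SliceHom f f :=
  {| smor := idm (sdom f); smor_comm := compm1 (sarr f) |}.

Lemma slice_comp_comm (C : Category) (Y : C) (f g h : SliceOb Y)
    (k : SliceHom g h) (l : SliceHom f g) : sarr h ∘ (smor k ∘ smor l) = sarr f.
Proof. now rewrite compA, (smor_comm k), (smor_comm l). Qed.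

Definition slice_comp (C : Category) (Y : C) (f g h : SliceOb Y)
    (k : SliceHom g h) (l : SliceHom f g) : SliceHom f h :=
  {| smor := smor k ∘ smor l; smor_comm := slice_comp_comm k l |}.

Definition Slice (C : Category) (Y : C) : Category.
Proof.
refine {| Ob := SliceOb Y; Hom := @SliceHom C Y; idm := @slice_id C Y;
          comp := @slice_comp C Y |}.
- intros; apply SliceHom_eq, comp1m.
- intros; apply SliceHom_eq, compm1.
- intros; apply SliceHom_eq, compA.
Defined.

Record ObRelation (C : Category) (X : C) := {
  Psi : C;
  eta : Hom X Psi;
  eps0 : Hom Psi X;
  eps1 : Hom Psi X;
  eps0_eta : eps0 ∘ eta = idm X;
  eps1_eta : eps1 ∘ eta = idm X
}.

Record Relation (C : Category) := {
  rel_ob :> forall X : C, ObRelation X;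
  PsiM : forall (X Y : C) (f : Hom X Y), Hom (Psi (rel_ob X)) (Psi (rel_ob Y));
  eps0_nat : forall (X Y : C) (f : Hom X Y),
    eps0 (rel_ob Y) ∘ PsiM f = f ∘ eps0 (rel_ob X);
  eps1_nat : forall (X Y : C) (f : Hom X Y),
    eps1 (rel_ob Y) ∘ PsiM f = f ∘ eps1 (rel_ob X);
  eta_nat : forall (X Y : C) (f : Hom X Y),
    PsiM f ∘ eta (rel_ob X) = eta (rel_ob Y) ∘ f
}.

Arguments PsiM {C} R {X Y} f : rename.

Record Factorization (C : Category) := {
  Phi : forall (X Y : C) (f : Hom X Y), C;
  lam : forall (X Y : C) (f : Hom X Y), Hom X (Phi f);
  rho : forall (X Y : C) (f : Hom X Y), Hom (Phi f) Y;
  rho_lam : forall (X Y : C) (f : Hom X Y), rho f ∘ lam f = f;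
  PhiM : forall (X Y X' Y' : C) (f : Hom X Y) (g : Hom X' Y')
    (alpha : Hom X X') (beta : Hom Y Y'), g ∘ alpha = beta ∘ f -> Hom (Phi f) (Phi g);
  PhiM_lam : forall (X Y X' Y' : C) (f : Hom X Y) (g : Hom X' Y')
    (alpha : Hom X X') (beta : Hom Y Y') (e : g ∘ alpha = beta ∘ f),
    PhiM e ∘ lam f = lam g ∘ alpha;
  rho_PhiM : forall (X Y X' Y' : C) (f : Hom X Y) (g : Hom X' Y')
    (alpha : Hom X X') (beta : Hom Y Y') (e : g ∘ alpha = beta ∘ f),
    rho g ∘ PhiM e = beta ∘ rho f
}.

Arguments Phi {C} F {X Y} f : rename.
Arguments lam {C} F {X Y} f : rename.
Arguments rho {C} F {X Y} f : rename.

Definition coalg (C : Category) (F : Factorization C) : MorClass C :=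
  fun X Y f => exists s : Hom Y (Phi F f), s ∘ f = lam F f /\ rho F f ∘ s = idm Y.

Definition alg (C : Category) (F : Factorization C) : MorClass C :=
  fun X Y f => exists s : Hom (Phi F f) X, s ∘ lam F f = idm X /\ f ∘ s = rho F f.

Definition is_weak_factorization_structure (C : Category) (F : Factorization C) : Prop :=
  forall (X Y : C) (f : Hom X Y),
    coalg F (lam F f) /\ alg F (rho F f).

Section RelationFactorization.

Variables (C : Category) (L : FiniteLimits C) (R : Relation C).

Lemma FR_lam_comm (X Y : C) (f : Hom X Y) :
  f ∘ idm X = eps0 (R Y) ∘ (eta (R Y) ∘ f).
Proof. now rewrite compm1, compA, eps0_eta, comp1m. Qed.

Lemma FR_rho_lam (X Y : C) (f : Hom X Y) :
  (eps1 (R Y) ∘ pb2 L f (eps0 (R Y))) ∘ pair L (FR_lam_comm f) = f.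
Proof. now rewrite <- compA, pb2_pair, compA, eps1_eta, comp1m. Qed.

Lemma FR_map_comm (X Y X' Y' : C) (f : Hom X Y) (g : Hom X' Y')
    (alpha : Hom X X') (beta : Hom Y Y') : g ∘ alpha = beta ∘ f ->
  g ∘ (alpha ∘ pb1 L f (eps0 (R Y))) = eps0 (R Y') ∘ (PsiM R beta ∘ pb2 L f (eps0 (R Y))).
Proof.
intros e.
now rewrite !compA, e, eps0_nat, <- !compA, pb_comm.
Qed.

Lemma FR_map_lam (X Y X' Y' : C) (f : Hom X Y) (g : Hom X' Y')
    (alpha : Hom X X') (beta : Hom Y Y') (e : g ∘ alpha = beta ∘ f) :
  pair L (FR_map_comm e) ∘ pair L (FR_lam_comm f) = pair L (FR_lam_comm g) ∘ alpha.
Proof.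
apply pair_uniq; rewrite !compA.
- now rewrite !pb1_pair, <- compA, pb1_pair, compm1, comp1m.
- now rewrite !pb2_pair, <- compA, pb2_pair, compA, eta_nat, <- !compA, e.
Qed.

Lemma FR_rho_map (X Y X' Y' : C) (f : Hom X Y) (g : Hom X' Y')
    (alpha : Hom X X') (beta : Hom Y Y') (e : g ∘ alpha = beta ∘ f) :
  (eps1 (R Y') ∘ pb2 L g (eps0 (R Y'))) ∘ pair L (FR_map_comm e)
  = beta ∘ (eps1 (R Y) ∘ pb2 L f (eps0 (R Y))).
Proof. now rewrite <- compA, pb2_pair, !compA, eps1_nat. Qed.

Definition FR : Factorization C := {|
  Phi := fun X Y f => pb L f (eps0 (R Y));
  lam := fun X Y f => pair L (FR_lam_comm f);
  rho := fun X Y f => eps1 (R Y) ∘ pb2 L f (eps0 (R Y));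
  rho_lam := FR_rho_lam;
  PhiM := fun X Y X' Y' f g alpha beta e => pair L (FR_map_comm e);
  PhiM_lam := FR_map_lam;
  rho_PhiM := FR_rho_map
|}.

End RelationFactorization.

Definition is_display_map_category (C : Category) (D : MorClass C) : Prop :=
  (forall (X Y : C) (f : Hom X Y), is_iso f -> D X Y f) /\
  (forall (X T : C) (f : Hom X T), is_terminal T -> D X T f) /\
  (forall (P A B Z : C) (p : Hom P A) (q : Hom P B) (a : Hom A Z) (b : Hom B Z),
     is_pullback p q a b -> D B Z b -> D P A p).

Definition models_Sigma (C : Category) (D : MorClass C) : Prop :=
  forall (X Y Z : C) (f : Hom X Y) (g : Hom Y Z), D X Y f -> D Y Z g -> D X Z (g ∘ f).

Section IdentityTypes.

Variables (C : Category) (L : FiniteLimits C).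

Lemma id_boundary_comm (Y : C) (f : Slice Y) (I : ObRelation f) :
  sarr f ∘ smor (eps0 I) = sarr f ∘ smor (eps1 I).
Proof. now rewrite !smor_comm. Qed.

(* [(eps0, eps1) : Id(f) -> X x_Y X] *)
Definition id_boundary (Y : C) (f : Slice Y) (I : ObRelation f) :
    Hom (sdom (Psi I)) (pb L (sarr f) (sarr f)) :=
  pair L (id_boundary_comm I).

Lemma section_comm (A X E : C) (alpha : Hom A X) (r : Hom X E) (e : Hom E X) :
  e ∘ r = idm X -> alpha ∘ idm A = e ∘ (r ∘ alpha).
Proof. intros er; now rewrite compA, er, compm1, comp1m. Qed.

(* For a section [r] of [e], the morphism [(1_A, r alpha) : A -> A x_X E]. *)
Definition refl_along (A X E : C) (alpha : Hom A X) (r : Hom X E) (e : Hom E X)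
    (er : e ∘ r = idm X) : Hom A (pb L alpha e) :=
  pair L (section_comm alpha er).

Definition is_identity_type (D : MorClass C) (Y : C) (f : Slice Y) (I : ObRelation f) : Prop :=
  D _ _ (id_boundary I) /\
  (forall (A : C) (alpha : Hom A (sdom f)),
     LLP D (refl_along alpha (f_equal (@smor C Y f f) (eps0_eta I))) /\
     LLP D (refl_along alpha (f_equal (@smor C Y f f) (eps1_eta I)))).

(* Identity types are only considered in display map categories that model
   Sigma-types, so modelling Id-types includes these two conditions. *)
Definition models_Id (D : MorClass C) : Prop :=
  is_display_map_category D /\ models_Sigma D /\
  forall Y : C, exists I : Relation (Slice Y),
    forall f : Slice Y, D _ _ (sarr f) -> is_identity_type D (I f).

End IdentityTypes.

Section IdPresentation.

Variables (C : Category) (L : FiniteLimits C).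

Definition to_one (X : C) : Slice (one L) := {| sdom := X; sarr := bang L X |}.

Definition to_one_map (X Y : C) (f : Hom X Y) : Hom (to_one X) (to_one Y) :=
  {| smor := f : Hom (sdom (to_one X)) (sdom (to_one Y));
     smor_comm := bang_uniq (bang L Y ∘ f) |}.

(* A relation on [X], seen as a relation on [X -> *] in the slice over [*]. *)
Definition to_one_relation (X : C) (S : ObRelation X) : ObRelation (to_one X).
Proof.
refine (@Build_ObRelation (Slice (one L)) (to_one X) (to_one (Psi S))
  (to_one_map (eta S)) (to_one_map (eps0 S)) (to_one_map (eps1 S)) _ _).
- apply SliceHom_eq, eps0_eta.
- apply SliceHom_eq, eps1_eta.
Defined.

Definition is_Id_presentation (R : Relation C) : Prop :=
  is_weak_factorization_structure (FR L R) /\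
  forall X : C, is_identity_type L (alg (FR L R)) (to_one_relation (R X)).

End IdPresentation.

(* Main.v *)
From Stdlib Require Import ProofIrrelevance.
Require Import Defs.

Set Implicit Arguments.
Unset Strict Implicit.
Unset Printing Implicit Defensive.

Local Open Scope cat_scope.

(** Write [D] for the right class [alg (FR L R)]; the left class is [LLP D].
    Take for [Id(f)] the middle object of the factorization of the diagonal of
    [f], so that its boundary is in [D] and its reflexivity [r] is in [LLP D].
    It remains to see that [r], a section of a map in [D] over [X], stays in
    [LLP D] after base change along any [alpha : A -> X].

    Frobenius property: [LLP D] is stable under pullback along maps in [D].
    Indeed a map in [LLP D] is a strong deformation retract for the paths
    [Psi], and transport along reversed paths (this is the hypothesis on
    [eps1]) lifts the deformation along a map in [D].

    Factor [alpha] as [rho lam].  Base change along [rho] preserves [LLP D] by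
    Frobenius.  For base change along [lam], the comparison map between the
    total spaces is in [LLP D] by Frobenius, and it can be cancelled since all
    objects are fibrant. *)

(** * Pullback squares *)

Section Pullbacks.

Variables (C : Category) (L : FiniteLimits C).

Lemma pb_is_pullback (A B Z : C) (a : Hom A Z) (b : Hom B Z) :
  is_pullback (pb1 L a b) (pb2 L a b) a b.
Proof.
split; [apply pb_comm|].
intros T u v e; exists (pair L e); split.
- split; [apply pb1_pair | apply pb2_pair].
- intros h [h1 h2]; apply pair_uniq.
  + now rewrite pb1_pair, h1.
  + now rewrite pb2_pair, h2.
Qed.

Lemma is_pullback_sym (P A B Z : C) (p : Hom P A) (q : Hom P B) (a : Hom A Z)
    (b : Hom B Z) : is_pullback p q a b -> is_pullback q p b a.
Proof.
intros [e univ]; split; [now symmetry|].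
intros T u v euv.
destruct (univ T v u (eq_sym euv)) as [h [[h1 h2] hu]].
exists h; split; [now split|].
intros k [k1 k2]; now apply hu.
Qed.

Lemma is_pullback_mono (P A B Z : C) (p : Hom P A) (q : Hom P B) (a : Hom A Z)
    (b : Hom B Z) (T : C) (h k : Hom T P) : is_pullback p q a b ->
  p ∘ h = p ∘ k -> q ∘ h = q ∘ k -> h = k.
Proof.
intros [e univ] hp hq.
assert (c : a ∘ (p ∘ k) = b ∘ (q ∘ k)) by now rewrite !compA, e.
destruct (univ T _ _ c) as [m [_ mu]].
transitivity m; [symmetry|]; now apply mu.
Qed.

(** This presents [refl_along] as a base change of [r], the form to which Frobenius applies. If
    [pb2 ∘ u = r ∘ v], applying [e] gives [v = alpha ∘ pb1 ∘ u], so the [A]-component determines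
    everything. *)
Lemma refl_along_is_pullback (A X E : C) (alpha : Hom A X) (r : Hom X E)
    (e : Hom E X) (er : e ∘ r = idm X) :
  is_pullback (refl_along L alpha er) alpha (pb2 L alpha e) r.
Proof.
unfold refl_along; split; [apply pb2_pair|].
intros T u v euv; exists (pb1 L alpha e ∘ u).
assert (ev : alpha ∘ (pb1 L alpha e ∘ u) = v).
{ now rewrite compA, pb_comm, <- compA, euv, compA, er, comp1m. }
split; [split|].
- apply pair_uniq; rewrite compA.
  + now rewrite pb1_pair, comp1m.
  + now rewrite pb2_pair, <- compA, ev, euv.
- exact ev.
- intros h [<- _]; now rewrite compA, pb1_pair, comp1m.
Qed.

End Pullbacks.

(** * Closure properties of left lifting classes *)

Section Lifting.

Variables (C : Category) (D : MorClass C).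

Lemma LLP_comp (X Y Z : C) (f : Hom X Y) (g : Hom Y Z) :
  LLP D f -> LLP D g -> LLP D (g ∘ f).
Proof.
intros hf hg U V d hd u v e.
destruct (hf U V d hd u (v ∘ g)) as [h [h1 h2]]; [now rewrite e, compA|].
destruct (hg U V d hd h v h2) as [k [k1 k2]].
exists k; split; [now rewrite compA, k1 | exact k2].
Qed.

(* Fibrancy of [V] is used to extend the bottom of a square along [j]. *)
Lemma LLP_cancel (L : FiniteLimits C) (X Y Z : C) (r : Hom X Y) (j : Hom Y Z) :
  (forall V : C, D (bang L V)) -> LLP D j -> LLP D (j ∘ r) -> LLP D r.
Proof.
intros fib hj hjr U V d hd u v e.
destruct (hj V (one L) (bang L V) (fib V) v (bang L Z)) as [w [w1 _]].
{ now rewrite (bang_uniq (bang L V ∘ v)), (bang_uniq (bang L Z ∘ j)). }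
destruct (hjr U V d hd u w) as [h [h1 h2]]; [now rewrite compA, w1|].
exists (h ∘ j); split; [now rewrite <- compA|].
now rewrite compA, h2.
Qed.

End Lifting.

(** * Weak factorization structures and their algebras *)

Section WeakFactorization.

Variables (C : Category) (F : Factorization C).

Lemma coalg_LLP_alg (X Y : C) (f : Hom X Y) : coalg F f -> LLP (alg F) f.
Proof.
intros [s [s1 s2]] U V g [t [t1 t2]] u v e.
exists (t ∘ (PhiM F e ∘ s)); split.
- now rewrite <- !compA, s1, PhiM_lam, compA, t1, comp1m.
- now rewrite !compA, t2, rho_PhiM, <- compA, s2, compm1.
Qed.

Hypothesis hF : is_weak_factorization_structure F.

Lemma LLP_alg_coalg (X Y : C) (f : Hom X Y) : LLP (alg F) f -> coalg F f.
Proof.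
intros hf; apply (hf _ _ (rho F f)); [apply hF|].
now rewrite rho_lam, comp1m.
Qed.

Lemma lam_LLP_alg (X Y : C) (f : Hom X Y) : LLP (alg F) (lam F f).
Proof. apply coalg_LLP_alg, hF. Qed.

(** Retract argument: a lift of [lam F g] against [g] is an algebra structure. Closure of [alg F]
    under pullback and composition thereby reduces to lifting. *)
Lemma alg_of_lifts (X Y : C) (g : Hom X Y) :
  (forall (A B : C) (j : Hom A B), LLP (alg F) j -> has_lift j g) -> alg F g.
Proof.
intros hg; apply (hg _ _ _ (lam_LLP_alg (f := g))).
now rewrite rho_lam, compm1.
Qed.

Lemma alg_iso (X Y : C) (f : Hom X Y) : is_iso f -> alg F f.
Proof.
intros [g [gf fg]]; exists (g ∘ rho F f); split.
- now rewrite <- compA, rho_lam.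
- now rewrite compA, fg, comp1m.
Qed.

Lemma alg_pullback (P A B Z : C) (p : Hom P A) (q : Hom P B) (a : Hom A Z)
    (b : Hom B Z) : is_pullback p q a b -> alg F b -> alg F p.
Proof.
intros hp hb; apply alg_of_lifts; intros S T j hj u v e.
destruct (hj _ _ b hb (q ∘ u) (a ∘ v)) as [h [h1 h2]].
{ now rewrite compA, <- (proj1 hp), <- !compA, e. }
destruct (proj2 hp T v h (eq_sym h2)) as [k [[k1 k2] _]].
exists k; split; [|exact k1].
apply (is_pullback_mono hp); rewrite compA.
- now rewrite k1.
- now rewrite k2.
Qed.

Lemma alg_comp (X Y Z : C) (f : Hom X Y) (g : Hom Y Z) :
  alg F f -> alg F g -> alg F (g ∘ f).
Proof.
intros hf hg; apply alg_of_lifts; intros S T j hj u v e.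
destruct (hj _ _ g hg (f ∘ u) v) as [h [h1 h2]]; [now rewrite compA|].
destruct (hj _ _ f hf u h (eq_sym h1)) as [k [k1 k2]].
exists k; split; [exact k1|].
now rewrite <- compA, k2.
Qed.

End WeakFactorization.

Lemma alg_FR_terminal (C : Category) (L : FiniteLimits C) (R : Relation C)
    (X T : C) (f : Hom X T) : is_terminal T -> alg (FR L R) f.
Proof.
intros hT; exists (pb1 L f (eps0 (R T))); split; [apply pb1_pair|].
destruct (hT (pb L f (eps0 (R T)))) as [m [_ mu]].
transitivity m; [symmetry|]; now apply mu.
Qed.

(** * Paths, transport and the Frobenius property *)

Section IdentityTypesOfDisplayMaps.

Variables (C : Category) (L : FiniteLimits C) (R : Relation C).
Hypothesis hR : is_Id_presentation L R.

Local Notation D := (alg (FR L R)).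

Lemma one_is_terminal : is_terminal (one L).
Proof.
intros X; exists (bang L X); split; [easy|].
intros f _; symmetry; apply bang_uniq.
Qed.

Lemma objects_fibrant (X : C) : D (bang L X).
Proof. apply alg_FR_terminal, one_is_terminal. Qed.

(** Maps that agree along a left map are joined by a path constant along it: lift against the
    boundary of [Psi (R X)]. *)
Lemma path_lift (A B X : C) (j : Hom A B) (u : Hom A X) (a b : Hom B X) :
  LLP D j -> a ∘ j = u -> b ∘ j = u ->
  exists h : Hom B (Psi (R X)),
    h ∘ j = eta (R X) ∘ u /\ eps0 (R X) ∘ h = a /\ eps1 (R X) ∘ h = b.
Proof.
intros hj ea eb.
assert (c : bang L X ∘ a = bang L X ∘ b).
{ now rewrite (bang_uniq (_ ∘ a)), (bang_uniq (_ ∘ b)). }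
destruct (hj _ _ _ (proj1 (proj2 hR X)) (eta (R X) ∘ u) (pair L c))
  as [h [h1 h2]].
{ unfold id_boundary; apply pair_uniq; rewrite !compA.
  - rewrite !pb1_pair; simpl; now rewrite eps0_eta, comp1m, ea.
  - rewrite !pb2_pair; simpl; now rewrite eps1_eta, comp1m, eb. }
exists h; split; [exact h1|].
pose proof (f_equal (comp (pb1 L _ _)) h2) as p1.
pose proof (f_equal (comp (pb2 L _ _)) h2) as p2.
unfold id_boundary in p1, p2.
rewrite compA, !pb1_pair in p1; rewrite compA, !pb2_pair in p2.
now split.
Qed.

Lemma refl_along_eps1_LLP (A X : C) (alpha : Hom A X) :
  LLP D (refl_along L alpha (eps1_eta (R X))).
Proof.
destruct (proj2 (proj2 hR X) A alpha) as [_ h]; simpl in h.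
(* The hypothesis comes from the slice over [one L]; it differs from the goal only in the proof of
   the section equation. *)
set (e := f_equal _ _) in h; simpl in e.
now rewrite (proof_irrelevance _ (eps1_eta (R X)) e).
Qed.

Lemma frobenius (E' E A B : C) (i : Hom E' E) (p' : Hom E' A) (p : Hom E B)
    (j : Hom A B) : is_pullback i p' p j -> D p -> LLP D j -> LLP D i.
Proof.
intros hi hp hj.
destruct (LLP_alg_coalg (proj1 hR) hj) as [s [s1 s2]].
simpl in s, s1, s2.
(* The coalgebra structure splits into a retraction [q] of [j] and a homotopy [H] from [j ∘ q] to
   the identity, constant along [j]. *)
pose (q := pb1 L j (eps0 (R B)) ∘ s).
pose (H := pb2 L j (eps0 (R B)) ∘ s).
assert (qj : q ∘ j = idm A).
{ unfold q; rewrite <- compA, s1; apply pb1_pair. }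
assert (Hj : H ∘ j = eta (R B) ∘ j).
{ unfold H; rewrite <- compA, s1; apply pb2_pair. }
assert (H0 : eps0 (R B) ∘ H = j ∘ q).
{ unfold H, q; now rewrite !compA, pb_comm. }
assert (H1 : eps1 (R B) ∘ H = idm B).
{ unfold H; rewrite compA; exact s2. }
pose proof (refl_along_eps1_LLP (alpha := p)) as hl.
set (l := refl_along _ _ _) in hl.
assert (l1 : pb1 L p (eps1 (R B)) ∘ l = idm E) by apply pb1_pair.
assert (l2 : pb2 L p (eps1 (R B)) ∘ l = eta (R B) ∘ p) by apply pb2_pair.
(* Transport [t] moves a point of [E] over the end of a path to one over its start, and fixes points
   over constant paths. *)
destruct (hl _ _ p hp (idm E) (eps0 (R B) ∘ pb2 L p (eps1 (R B))))
  as [t [t1 t2]].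
{ rewrite compm1, <- compA.
  now rewrite l2, compA, eps0_eta, comp1m. }
(* [th] is a path in [E] from the transported point to the original one. *)
destruct (path_lift hl t1 l1) as [th [th1 [th2 th3]]].
assert (c : p ∘ idm E = eps1 (R B) ∘ (H ∘ p)).
{ now rewrite compm1, compA, H1, comp1m. }
assert (ci : pair L c ∘ i = l ∘ i).
{ apply pair_uniq; rewrite !compA.
  - now rewrite pb1_pair, l1.
  - rewrite pb2_pair, l2, <- !compA, (proj1 hi), !compA.
    now rewrite Hj. }
assert (ct : p ∘ (t ∘ pair L c) = j ∘ (q ∘ p)).
{ rewrite compA; etransitivity.
  - apply (f_equal (fun m => m ∘ pair L c)); exact t2.
  - now rewrite <- compA, pb2_pair, compA, H0, compA. }
(* Transport back along [H ∘ p] ends over the image of [j], hence factors through [E']; with [th],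
   this makes [i] a coalgebra. *)
destruct (proj2 hi E _ _ ct) as [q' [[q1 q2] _]].
apply coalg_LLP_alg.
assert (cs : i ∘ q' = eps0 (R E) ∘ (th ∘ pair L c)).
{ now rewrite q1, compA, th2. }
exists (pair L cs); split; simpl.
- apply pair_uniq; rewrite !compA.
  + rewrite !pb1_pair; apply (is_pullback_mono hi); rewrite compm1, compA.
    * rewrite q1, <- compA, ci, compA.
      transitivity (idm E ∘ i); [now f_equal | apply comp1m].
    * rewrite q2, <- compA, (proj1 hi), compA.
      now rewrite qj, comp1m.
  + rewrite !pb2_pair, <- compA, ci, compA.
    f_equal; etransitivity; [exact th1 | apply compm1].
- now rewrite <- compA, pb2_pair, compA, th3, pb1_pair.
Qed.

Lemma refl_along_LLP (A X E : C) (alpha : Hom A X) (r : Hom X E) (e : Hom E X)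
    (er : e ∘ r = idm X) : D e -> LLP D r -> LLP D (refl_along L alpha er).
Proof.
intros he hr; pose proof (proj1 hR) as hF.
assert (fac : exists (B : C) (m : Hom B X) (k : Hom A B),
  m ∘ k = alpha /\ D m /\ LLP D k).
{ exists _, (rho (FR L R) alpha), (lam (FR L R) alpha).
  split; [apply rho_lam | split; [apply hF | apply (lam_LLP_alg hF)]]. }
destruct fac as [B [m [k [mk [hm hk]]]]].
(* Base change along the right factor [m], by Frobenius. *)
assert (hrm : LLP D (refl_along L m er)).
{ apply (frobenius (refl_along_is_pullback L m er)); [|exact hr].
  apply (alg_pullback hF (is_pullback_sym (pb_is_pullback L m e)) hm). }
assert (c : m ∘ (k ∘ pb1 L alpha e) = e ∘ pb2 L alpha e).
{ rewrite compA, mk; apply pb_comm. }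
apply (LLP_cancel (j := pair L c) objects_fibrant).
(* The comparison map is the base change of [k] along [pb1 L m e], itself a base change of [e]. *)
- apply (frobenius (p' := pb1 L alpha e) (p := pb1 L m e) (j := k)).
  + split; [apply pb1_pair|].
    intros T u v euv.
    assert (cT : alpha ∘ v = e ∘ (pb2 L m e ∘ u)).
    { now rewrite <- mk, <- compA, <- euv, !compA, pb_comm. }
    exists (pair L cT); split; [split|].
    * apply pair_uniq; rewrite compA.
      -- now rewrite pb1_pair, <- compA, pb1_pair.
      -- now rewrite pb2_pair, pb2_pair.
    * apply pb1_pair.
    * intros h [<- <-]; apply pair_uniq.
      -- now rewrite pb1_pair.
      -- now rewrite pb2_pair, compA, pb2_pair.
  + apply (alg_pullback hF (pb_is_pullback L m e) he).
  + exact hk.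
- replace (pair L c ∘ refl_along L alpha er) with (refl_along L m er ∘ k).
  + apply LLP_comp; [exact hk | exact hrm].
  + unfold refl_along; apply pair_uniq; rewrite !compA.
    * now rewrite !pb1_pair, <- compA, pb1_pair, comp1m, compm1.
    * now rewrite !pb2_pair, <- compA, mk.
Qed.

(** * Identity types from factored diagonals *)

Definition diagonal (X Y : C) (f : Hom X Y) : Hom X (pb L f f) :=
  pair L (eq_refl (f ∘ idm X)).

Definition diagonal_path_ob (Y : C) (f : Slice Y) : Slice Y :=
  {| sdom := Phi (FR L R) (diagonal (sarr f));
     sarr := sarr f ∘ (pb1 L (sarr f) (sarr f) ∘ rho (FR L R) (diagonal (sarr f))) |}.

Lemma diagonal_eps0_lam (X Y : C) (f : Hom X Y) :
  (pb1 L f f ∘ rho (FR L R) (diagonal f)) ∘ lam (FR L R) (diagonal f) = idm X.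
Proof. rewrite <- compA, rho_lam; apply pb1_pair. Qed.

Lemma diagonal_eps1_lam (X Y : C) (f : Hom X Y) :
  (pb2 L f f ∘ rho (FR L R) (diagonal f)) ∘ lam (FR L R) (diagonal f) = idm X.
Proof. rewrite <- compA, rho_lam; apply pb2_pair. Qed.

Definition diagonal_relation (Y : C) (f : Slice Y) : ObRelation f.
Proof.
refine (@Build_ObRelation (Slice Y) f (diagonal_path_ob f)
  (@Build_SliceHom C Y f (diagonal_path_ob f) (lam (FR L R) (diagonal (sarr f))) _)
  (@Build_SliceHom C Y (diagonal_path_ob f) f
     (pb1 L (sarr f) (sarr f) ∘ rho (FR L R) (diagonal (sarr f))) _)
  (@Build_SliceHom C Y (diagonal_path_ob f) f
     (pb2 L (sarr f) (sarr f) ∘ rho (FR L R) (diagonal (sarr f))) _) _ _).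
Unshelve.
- apply SliceHom_eq, diagonal_eps0_lam.
- apply SliceHom_eq, diagonal_eps1_lam.
- cbn [sdom sarr diagonal_path_ob]; now rewrite <- compA, diagonal_eps0_lam, compm1.
- reflexivity.
- cbn [sdom sarr diagonal_path_ob]; now rewrite !compA, pb_comm.
Defined.

Lemma diagonal_map_comm (Y : C) (f g : Slice Y) (h : Hom f g) :
  sarr g ∘ (smor h ∘ pb1 L (sarr f) (sarr f))
  = sarr g ∘ (smor h ∘ pb2 L (sarr f) (sarr f)).
Proof. rewrite !compA, smor_comm; apply pb_comm. Qed.

(** This is the square of diagonals to which [PhiM] is applied to obtain the action of [h] on
    paths. *)
Lemma diagonal_nat (Y : C) (f g : Slice Y) (h : Hom f g) :
  diagonal (sarr g) ∘ smor h
  = pair L (diagonal_map_comm h) ∘ diagonal (sarr f).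
Proof.
unfold diagonal; apply pair_uniq; rewrite !compA.
- now rewrite !pb1_pair, <- compA, pb1_pair, comp1m, compm1.
- now rewrite !pb2_pair, <- compA, pb2_pair, comp1m, compm1.
Qed.

Lemma diagonal_eps0_nat (Y : C) (f g : Slice Y) (h : Hom f g) :
  (pb1 L (sarr g) (sarr g) ∘ rho (FR L R) (diagonal (sarr g)))
    ∘ PhiM (FR L R) (diagonal_nat h)
  = smor h ∘ (pb1 L (sarr f) (sarr f) ∘ rho (FR L R) (diagonal (sarr f))).
Proof. now rewrite <- compA, rho_PhiM, compA, pb1_pair, compA. Qed.

Lemma diagonal_eps1_nat (Y : C) (f g : Slice Y) (h : Hom f g) :
  (pb2 L (sarr g) (sarr g) ∘ rho (FR L R) (diagonal (sarr g)))
    ∘ PhiM (FR L R) (diagonal_nat h)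
  = smor h ∘ (pb2 L (sarr f) (sarr f) ∘ rho (FR L R) (diagonal (sarr f))).
Proof. now rewrite <- compA, rho_PhiM, compA, pb2_pair, compA. Qed.

Definition diagonal_PsiM (Y : C) (f g : Slice Y) (h : Hom f g) :
  Hom (diagonal_path_ob f) (diagonal_path_ob g).
Proof.
refine (@Build_SliceHom C Y (diagonal_path_ob f) (diagonal_path_ob g)
  (PhiM (FR L R) (diagonal_nat h)) _).
cbn [sdom sarr diagonal_path_ob]; now rewrite <- compA, diagonal_eps0_nat, compA, smor_comm.
Defined.

Definition diagonal_Relation (Y : C) : Relation (Slice Y).
Proof.
refine (@Build_Relation (Slice Y) (@diagonal_relation Y) (@diagonal_PsiM Y) _ _ _);
  intros f g h; apply SliceHom_eq.
- apply diagonal_eps0_nat.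
- apply diagonal_eps1_nat.
- exact (PhiM_lam (FR L R) (diagonal_nat h)).
Defined.

Lemma diagonal_is_identity_type (Y : C) (f : Slice Y) :
  D (sarr f) -> is_identity_type L (alg (FR L R)) (diagonal_relation f).
Proof.
intros hf; pose proof (proj1 hR) as hF.
pose proof (pb_is_pullback L (sarr f) (sarr f)) as hp.
split.
- replace (id_boundary L (diagonal_relation f))
    with (rho (FR L R) (diagonal (sarr f))); [apply hF|].
  unfold id_boundary; apply pair_uniq.
  + now rewrite pb1_pair.
  + now rewrite pb2_pair.
(* Each endpoint map is [rho] followed by a projection of the kernel pair, which is a base change of
   [sarr f]. *)
- intros A alpha; split; (apply refl_along_LLP; [|apply (lam_LLP_alg hF)]);
    apply (alg_comp hF); [apply hF| |apply hF|].
  + exact (alg_pullback hF hp hf).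
  + exact (alg_pullback hF (is_pullback_sym hp) hf).
Qed.

End IdentityTypesOfDisplayMaps.

Theorem proposition6p2 (C : Category) (L : FiniteLimits C) (R : Relation C)
  (hR : is_Id_presentation L R) :
  models_Id L (alg (FR L R)).
Proof.
pose proof (proj1 hR) as hF.
split; [|split].
- split; [|split].
  + intros X Y f; apply alg_iso.
  + intros X T f; apply alg_FR_terminal.
  + intros P A B Z p q a b; apply (alg_pullback hF).
- intros X Y Z f g; apply (alg_comp hF).
- intros Y; exists (diagonal_Relation L R Y); intros f hf.
  exact (diagonal_is_identity_type hR hf).
Qed.
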